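(* Let $\mathbb{K}=\mathbb{F}_q$ be a finite field and let $X$ be a complete simplicial toric variety over $\mathbb{K}$ with torsion-free class group $\operatorname{Cl}(X)\cong\mathbb{Z}^d$, total coordinate ring $S=\mathbb{K}[x_1,\dots,x_r]$ and degree matrix $\beta=[\beta_1\cdots\beta_r]$. Assume that the columns $\beta_1,\dots,\beta_r$ of $\beta$ lie in $\mathbb{N}^d$. Let $Q=[\mathbf{q}_1\cdots\mathbf{q}_r]\in M_{s\times r}(\mathbb{Z})$ be a matrix with non-negative entries, and let $Y_Q\subseteq T_X$ be the toric set parameterized by $Q$. Let $R=\mathbb{K}[x_1,\dots,x_r,y_1,\dots,y_s,z_1,\dots,z_d]$, a polynomial ring extending $S$. Then $I(Y_Q)=J\cap S$, where $$J=\left\langle \{x_i-\mathbf{y}^{\mathbf{q}_i}\mathbf{z}^{\beta_i}\}_{i=1}^{r}\cup\{y_i^{q-1}-1\}_{i=1}^{s}\right\rangle\subseteq R.$$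
   Context: Setting. $X$ is given by a fan $\Sigma$ in $\mathbb{R}^n$ with $r$ rays, whose primitive generators $\mathbf{v}_1,\dots,\mathbf{v}_r\in\mathbb{Z}^n$ span $\mathbb{R}^n$; $d=r-n$. Let $\phi:\mathbb{Z}^n\to\mathbb{Z}^r$ be the linear map given by the $r\times n$ matrix with rows $\mathbf{v}_1,\dots,\mathbf{v}_r$, and let $\beta:\mathbb{Z}^r\to\mathbb{Z}^d$ be a linear map (identified with a $d\times r$ integer matrix with columns $\beta_j=\beta(e_j)$) such that $0\to\mathbb{Z}^n\xrightarrow{\phi}\mathbb{Z}^r\xrightarrow{\beta}\mathbb{Z}^d\to 0$ is exact (so $\operatorname{Cl}(X)\cong\mathbb{Z}^d$). The ring $S$ is $\mathbb{Z}^d$-graded by $\deg(x_j)=\beta_j$. Here $\mathbb{N}$ denotes the non-negative integers. For $\mathbf{a}\in\mathbb{Z}^k$ and $\mathbf{t}=(t_1,\dots,t_k)$ write $\mathbf{t}^{\mathbf{a}}=t_1^{a_1}\cdots t_k^{a_k}$. Let $\mathbf{u}_1,\dots,\mathbf{u}_n$ be the columns of $\phi$, let $\pi:(\mathbb{K}^* )^r\to(\mathbb{K}^* )^n$, $\pi(\mathbf{t})=(\mathbf{t}^{\mathbf{u}_1},\dots,\mathbf{t}^{\mathbf{u}_n})$, and $G=\ker\pi$. The torus of $X$ is $T_X=(\mathbb{K}^* )^r/G$, with elements $[p_1:\cdots:p_r]:=G\cdot(p_1,\dots,p_r)$. For $Q=[\mathbf{q}_1\cdots\mathbf{q}_r]\in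 M_{s\times r}(\mathbb{Z})$ (columns $\mathbf{q}_i\in\mathbb{Z}^s$), the toric set parameterized by $Q$ is $Y_Q=\{[\mathbf{t}^{\mathbf{q}_1}:\cdots:\mathbf{t}^{\mathbf{q}_r}] : \mathbf{t}\in(\mathbb{K}^* )^s\}\subseteq T_X$. The vanishing ideal $I(Y)\subseteq S$ of a set $Y$ of points of $X$ is the ideal generated by all homogeneous polynomials of $S$ (for the $\mathbb{Z}^d$-grading) that vanish at all points of $Y$. *)

(* Defs.v *)
From mathcomp Require Import all_boot all_order all_algebra.
From mathcomp Require Import boolp classical_sets functions cardinality reals.
From mathcomp Require Import mpoly.

Set Implicit Arguments.
Unset Strict Implicit.
Unset Printing Implicit Defensive.

Import Order.TTheory GRing.Theory Num.Theory.
Local Open Scope classical_set_scope.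
Local Open Scope ring_scope.

(* Points of R^n and of the lattice Z^n are row vectors; a finite family of
   vectors is the matrix having them as its rows. *)
Section Fans.
Variables (R : realType) (n : nat).
Implicit Types (sigma tau : set 'rV[R]_n) (Sigma : set (set 'rV[R]_n)).

Definition lattice_mx m (N : 'M[int]_(m, n)) : 'M[R]_(m, n) :=
  map_mx (fun z : int => z%:~R) N.

Definition cone m (N : 'M[R]_(m, n)) : set 'rV[R]_n :=
  [set c *m N | c in [set c : 'rV[R]_m | forall i, 0 <= c 0 i]].

Definition rational_polyhedral sigma : Prop :=
  exists m (N : 'M[int]_(m, n)), sigma = cone (lattice_mx N).

Definition strongly_convex sigma : Prop :=
  forall x, sigma x -> sigma (- x) -> x = 0.

Definition face tau sigma : Prop :=
  exists u : 'cV[R]_n,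
    (forall x, sigma x -> 0 <= (x *m u) 0 0) /\
    tau = [set x | sigma x /\ (x *m u) 0 0 = 0].

Definition simplicial_cone sigma : Prop :=
  exists m (N : 'M[int]_(m, n)),
    row_free (lattice_mx N) /\ sigma = cone (lattice_mx N).

(* The rank of N is the dimension of the linear span of cone N, so it does not
   depend on the choice of N. *)
Definition one_dimensional sigma : Prop :=
  exists m (N : 'M[R]_(m, n)), sigma = cone N /\ \rank N = 1%N.

Record is_fan Sigma : Prop := IsFan {
  fan_finite : finite_set Sigma;
  fan_rational : forall sigma, Sigma sigma -> rational_polyhedral sigma;
  fan_pointed : forall sigma, Sigma sigma -> strongly_convex sigma;
  fan_face : forall sigma tau, Sigma sigma -> face tau sigma -> Sigma tau;
  fan_meet : forall sigma tau, Sigma sigma -> Sigma tau ->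
    face (sigma `&` tau) sigma /\ face (sigma `&` tau) tau
}.

Definition complete_fan Sigma : Prop :=
  \bigcup_(sigma in Sigma) sigma = setT.

Definition simplicial_fan Sigma : Prop :=
  forall sigma, Sigma sigma -> simplicial_cone sigma.

Definition rays Sigma : set (set 'rV[R]_n) :=
  [set rho | Sigma rho /\ one_dimensional rho].

(* Primitivity excludes the zero vector, because 0 = 0 *: w. *)
Definition primitive (v : 'rV[int]_n) : Prop :=
  forall (a : int) (w : 'rV[int]_n), v = a *: w -> a \is a GRing.unit.

Definition ray_of (v : 'rV[int]_n) : set 'rV[R]_n := cone (lattice_mx v).

Record ray_generators r Sigma (phi : 'M[int]_(r, n)) : Prop := RayGenerators {
  ray_primitive : forall i, primitive (row i phi);
  ray_inj : injective (fun i : 'I_r => ray_of (row i phi));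
  ray_range : range (fun i : 'I_r => ray_of (row i phi)) = rays Sigma;
  ray_span : row_full (lattice_mx phi)
}.

End Fans.

(* 0 -> Z^n -> Z^r -> Z^d -> 0 on column vectors. *)
Record short_exact n r d (phi : 'M[int]_(r, n)) (beta : 'M[int]_(d, r)) :
    Prop := ShortExact {
  exact_inj : injective (fun x : 'cV[int]_n => phi *m x);
  exact_mid : forall y : 'cV[int]_r,
    beta *m y = 0 <-> exists x : 'cV[int]_n, y = phi *m x;
  exact_surj : forall z : 'cV[int]_d, exists y : 'cV[int]_r, beta *m y = z
}.

Definition ideal_gen (A : comNzRingType) (G : set A) : set A :=
  [set f | exists cs : seq (A * A),
     (forall c, c \in cs -> G c.2) /\ f = \sum_(c <- cs) c.1 * c.2].

Section ToricPoints.
Variables (K : fieldType) (n r : nat) (phi : 'M[int]_(r, n)).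

Definition torus k : set ('I_k -> K) := [set t | forall i, t i != 0].

Definition zmonom k (t : 'I_k -> K) (a : 'cV[int]_k) : K :=
  \prod_i t i ^ a i 0.

Definition torus_map (t : 'I_r -> K) : 'I_n -> K :=
  fun j => zmonom t (col j phi).

Definition torus_ker : set ('I_r -> K) :=
  [set g | torus g /\ torus_map g = fun=> 1].

(* [p_1 : ... : p_r], the torus_ker-orbit of p. *)
Definition toric_point (p : 'I_r -> K) : set ('I_r -> K) :=
  [set (fun i => g i * p i) | g in torus_ker].

Definition toric_torus : set (set ('I_r -> K)) :=
  [set toric_point p | p in @torus r].

Definition toric_set s (Q : 'M[int]_(s, r)) : set (set ('I_r -> K)) :=
  [set toric_point (fun i => zmonom t (col i Q)) | t in @torus s].

Lemma toric_set_sub s (Q : 'M[int]_(s, r)) : toric_set Q `<=` toric_torus.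
Proof.
move=> _ [t tT <-]; exists (fun i => zmonom t (col i Q)) => // i.
by rewrite /zmonom; apply/prodf_neq0 => j _; rewrite expfz_neq0.
Qed.

End ToricPoints.

Arguments torus K k : clear implicits.
Arguments toric_set K {n r} phi {s} Q.

Section VanishingIdeal.
Variables (K : fieldType) (r d : nat) (beta : 'M[int]_(d, r)).

Definition beta_deg (m : 'X_{1..r}) : 'cV[int]_d :=
  \sum_(j < r) col j beta *+ m j.

Definition beta_homogeneous (f : {mpoly K[r]}) : Prop :=
  exists alpha, forall m, m \in msupp f -> beta_deg m = alpha.

(* A point is an orbit of coordinate vectors, and a polynomial vanishes at it
   when it vanishes at all of these vectors. *)
Definition vanishing_ideal (Y : set (set ('I_r -> K))) : set {mpoly K[r]} :=
  ideal_gen [set f : {mpoly K[r]} | beta_homogeneous f /\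
    forall P, Y P -> forall p, P p -> f.@[p] = 0].

End VanishingIdeal.

(* The ring K[x_1..x_r, y_1..y_s, z_1..z_d], with its variables in this order. *)
Section Extension.
Variables (K : finFieldType) (r s d : nat).
Local Notation A := {mpoly K[r + s + d]}.

Definition Xvar (i : 'I_r) : A := 'X_(lshift d (lshift s i)).
Definition Yvar (j : 'I_s) : A := 'X_(lshift d (rshift r j)).
Definition Zvar (k : 'I_d) : A := 'X_(rshift (r + s) k).

Definition embS (f : {mpoly K[r]}) : A := f \mPo [tuple Xvar i | i < r].

(* absz loses nothing: these are used with non-negative exponents only. *)
Definition ymonom (a : 'cV[int]_s) : A := \prod_j Yvar j ^+ absz (a j 0).
Definition zvmonom (a : 'cV[int]_d) : A := \prod_k Zvar k ^+ absz (a k 0).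

Definition ideal_J (Q : 'M[int]_(s, r)) (beta : 'M[int]_(d, r)) : set A :=
  ideal_gen (
    range (fun i : 'I_r =>
      Xvar i - ymonom (col i Q) * zvmonom (col i beta)) `|`
    range (fun j : 'I_s => Yvar j ^+ (#|K|.-1) - 1)).

End Extension.

Arguments embS {K r} s d f.
Arguments ideal_J K {r s d} Q beta.

(* Main.v *)
(* If f is homogeneous of degree a and vanishes on Y_Q, then modulo J it is
   congruent to z^a f(y^{q_1}, ..., y^{q_r}), and the second factor is a
   polynomial in y vanishing on (K^* )^s.  Reducing exponents modulo q - 1 turns
   such a polynomial into 0: its reduced coefficients are, up to sign, the sums
   over t in (K^* )^s of its values times monomials in t, by the power sums over
   K^*.  Conversely, for each t the substitution x_i -> t^{q_i} z^{beta_i},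
   y -> t, z -> z kills J, and the coefficient of z^a in the image of f is the
   value at t^Q of the component of degree a of f.  A homogeneous polynomial is
   multiplied by a scalar under G, because by exactness the exponents of two
   monomials of the same degree differ by an element of the image of phi; hence
   it vanishes on the whole orbit. *)

Require Import Defs.
From mathcomp Require Import all_boot all_order all_algebra all_field.
From mathcomp Require Import boolp classical_sets functions cardinality reals.
From mathcomp Require Import mpoly.

Set Implicit Arguments.
Unset Strict Implicit.
Unset Printing Implicit Defensive.

Import Order.TTheory GRing.Theory Num.Theory.
Local Open Scope classical_set_scope.
Local Open Scope ring_scope.

(** * Congruences modulo a generated ideal *)

Section IdealGen.
Variables (A : comNzRingType) (G : set A).
Local Notation I := (ideal_gen G).

Lemma ideal_gen_mem g : G g -> I g.
Proof.
move=> Gg; exists [:: (1, g)]; split; last by rewrite big_seq1 mul1r.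
by move=> c; rewrite inE => /eqP ->.
Qed.

Lemma ideal_gen0 : I 0.
Proof. by exists [::]; split=> //; rewrite big_nil. Qed.

Lemma ideal_genD f g : I f -> I g -> I (f + g).
Proof.
move=> [cs [csG ->]] [ds [dsG ->]]; exists (cs ++ ds); split; last first.
  by rewrite big_cat.
by move=> c; rewrite mem_cat => /orP[/csG|/dsG].
Qed.

Lemma ideal_genMl a f : I f -> I (a * f).
Proof.
move=> [cs [csG ->]]; exists [seq (a * c.1, c.2) | c <- cs]; split.
  by move=> c /mapP[c' /csG ? ->].
by rewrite big_map mulr_sumr; apply: eq_bigr => c _; rewrite mulrA.
Qed.

Lemma ideal_gen_sum (T : eqType) (s : seq T) (F : T -> A) :
  (forall x, x \in s -> I (F x)) -> I (\sum_(x <- s) F x).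
Proof.
move=> IF; rewrite big_seq; elim/big_ind: _ => //.
  exact: ideal_gen0.
exact: ideal_genD.
Qed.

Lemma ideal_genB_trans g f h : I (f - g) -> I (g - h) -> I (f - h).
Proof. by move=> fg gh; rewrite -[f](subrK g) -addrA; apply: ideal_genD. Qed.

Lemma ideal_genBM f f' g g' : I (f - f') -> I (g - g') -> I (f * g - f' * g').
Proof.
move=> If Ig; apply: (ideal_genB_trans (g := f' * g)).
  by rewrite -mulrBl mulrC; apply: ideal_genMl.
by rewrite -mulrBr; apply: ideal_genMl.
Qed.

Lemma ideal_genBX f g k : I (f - g) -> I (f ^+ k - g ^+ k).
Proof.
move=> Ifg; elim: k => [|k IHk]; first by rewrite !expr0 subrr; apply: ideal_gen0.
by rewrite !exprS; apply: ideal_genBM.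
Qed.

Lemma ideal_genB_prod (T : Type) (s : seq T) (F H : T -> A) :
  (forall x, I (F x - H x)) -> I (\prod_(x <- s) F x - \prod_(x <- s) H x).
Proof.
move=> IFH; elim: s => [|x s IHs].
  by rewrite !big_nil subrr; apply: ideal_gen0.
by rewrite !big_cons; apply: ideal_genBM.
Qed.

Lemma ideal_gen_kernel (B : comNzRingType) (h : {rmorphism A -> B}) f :
  (forall g, G g -> h g = 0) -> I f -> h f = 0.
Proof.
move=> hG [cs [csG ->]]; rewrite rmorph_sum big_seq big1 // => c /csG/hG hc.
by rewrite rmorphM hc mulr0.
Qed.

End IdealGen.

(** Congruence modulo an ideal survives sums, products and powers, hence polynomial substitution. *)
Lemma ideal_gen_comp_mpoly (K : comNzRingType) k l (G : set {mpoly K[l]})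
    (v w : k.-tuple {mpoly K[l]}) (f : {mpoly K[k]}) :
  (forall i, ideal_gen G (tnth v i - tnth w i)) ->
  ideal_gen G ((f \mPo v) - (f \mPo w)).
Proof.
move=> Gvw; rewrite !comp_mpolyE -sumrB; apply: ideal_gen_sum => m _.
rewrite -scalerBr -mul_mpolyC; apply: ideal_genMl.
by apply: ideal_genB_prod => i; apply: ideal_genBX.
Qed.

(** * Power sums over the nonzero elements of a finite field *)

Section PowerSums.
Variable K : finFieldType.
Local Notation N := (#|K|.-1).

Lemma natr_card_eq0 : #|K|%:R = 0 :> K.
Proof.
(* The sum of all elements is invariant under x -> x + 1. *)
apply: (addrI (\sum_(x : K) x)).
rewrite addr0 [RHS](reindex_inj (addIr 1)) /= big_split /=.
by rewrite sumr_const.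
Qed.

Lemma card_finField_pred_gt0 : (0 < N)%N.
Proof. by rewrite -subn1 subn_gt0 finNzRing_gt1. Qed.

Lemma expf_pred_card (x : K) : x != 0 -> x ^+ N = 1.
Proof.
move=> x0; apply: (mulfI x0).
by rewrite -exprS prednK ?expf_card ?mulr1 // ltnW ?finNzRing_gt1.
Qed.

(** Otherwise all [N] nonzero elements would be roots of unity of order [k %% N], a positive number
    smaller than [N]: too many roots. *)
Lemma exists_expf_neq1 k : ~~ (N %| k)%N -> exists2 x : K, x != 0 & x ^+ k != 1.
Proof.
rewrite /dvdn -lt0n => k0; apply/exists_inP; apply: contraT.
rewrite negb_exists_in => /forall_inP allx.
have : all (k %% N)%N.-unity_root (enum (predC1 (0 : K))).
  apply/allP => x; rewrite mem_enum inE => x0; apply/unity_rootP.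
  have := allx x x0; rewrite negbK => /eqP <-.
  by rewrite [in RHS](divn_eq k N) exprD mulnC exprM expf_pred_card // expr1n mul1r.
move=> /(max_unity_roots k0)/(_ (enum_uniq _)).
by rewrite -cardE cardC1 leqNgt ltn_mod card_finField_pred_gt0.
Qed.

(** If some nonzero [c] has [c ^+ k != 1], multiplication by [c] permutes the summation range and
    scales the sum by [c ^+ k], so the sum is 0. Otherwise it adds up [N] ones, and [N] is -1 in
    [K]. *)
Lemma sum_expf k :
  \sum_(x : K | x != 0) x ^+ k = if (N %| k)%N then -1 else 0.
Proof.
case: ifPn => [/dvdnP[l ->]|/exists_expf_neq1[c c0 ck]].
  transitivity (\sum_(x : K | x != 0) (1 : K)).
    apply: eq_bigr => x x0.
    by rewrite mulnC exprM expf_pred_card // expr1n.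
  rewrite sumr_const cardC1; apply/eqP; rewrite eq_sym -subr_eq0 -opprD oppr_eq0.
  rewrite -mulrS prednK ?(ltnW (finNzRing_gt1 _)) //.
  by rewrite natr_card_eq0.
set S := \sum_(_ | _) _.
suff : c ^+ k * S = S.
  move=> /eqP; rewrite -subr_eq0 -[X in _ - X]mul1r -mulrBl mulf_eq0 subr_eq0.
  by rewrite (negPf ck) => /eqP.
rewrite mulr_sumr [RHS](reindex_inj (mulfI c0)) /=.
apply: eq_big => [x|x _]; first by rewrite mulf_eq0 (negPf c0).
by rewrite exprMn.
Qed.

End PowerSums.

(** * Polynomials vanishing on the torus *)

Section TorusVanishing.
Variables (K : finFieldType) (s : nat).
Local Notation N := (#|K|.-1).

Definition mnm_mod (m : 'X_{1..s}) : 'X_{1..s} := [multinom (m j %% N)%N | j < s].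

(** Orthogonality of characters: on the torus the exponent [N.-1 * a j] acts as [- a j], and the sum
    factors into one power sum per coordinate. *)
Lemma sum_torus_monom (m a : 'X_{1..s}) :
  \sum_(t in ffun_on (predC1 (0 : K)))
    (\prod_j (t : {ffun 'I_s -> K}) j ^+ m j) * (\prod_j t j ^+ (N.-1 * a j)) =
  (-1) ^+ s * (mnm_mod m == mnm_mod a)%:R.
Proof.
transitivity (\prod_(j < s) \sum_(x | x != 0 :> K) x ^+ (m j + N.-1 * a j)).
  rewrite bigA_distr_big; apply: eq_bigr => t _; rewrite -big_split /=.
  by apply: eq_bigr => j _; rewrite exprD.
(* Adding [a j] completes [N.-1 * a j] to a multiple of [N]. *)
have dvdE j : (N %| m j + N.-1 * a j)%N = (mnm_mod m j == mnm_mod a j).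
  rewrite !mnmE /dvdn -[X in _ == X](mod0n N) -(eqn_modDr (a j)) add0n -addnA.
  by rewrite -mulSnr prednK ?card_finField_pred_gt0 // addnC mulnC modnMDl.
under eq_bigr do rewrite sum_expf dvdE.
case: eqP => [E|/eqP E].
  rewrite mulr1 -[in RHS](card_ord s) -prodr_const.
  by apply: eq_bigr => j _; rewrite E eqxx.
have [j /negPf Ej] : exists j, mnm_mod m j != mnm_mod a j.
  apply/existsP; apply: contraNT E; rewrite negb_exists => /forallP E.
  by apply/eqP/mnmP => j; apply/eqP; rewrite -[_ == _]negbK E.
by rewrite (bigD1 j) //= Ej mul0r mulr0.
Qed.

(** By orthogonality, the coefficient at a reduced exponent [a] is, up to the sign [(-1) ^+ s], the
    sum over the torus of [g] times the inverse of the monomial [a]. No term contributes at an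
    unreduced [a], since [mnm_mod] is idempotent. *)
Lemma torus_vanishing_mnm_mod (g : {mpoly K[s]}) :
  (forall t, torus K s t -> g.@[t] = 0) ->
  \sum_(m <- msupp g) g@_m *: 'X_[mnm_mod m] = 0 :> {mpoly K[s]}.
Proof.
move=> g0; apply/mpolyP => a; rewrite mcoeff0 raddf_sum /=.
under eq_bigr do rewrite mcoeffZ mcoeffX.
have [aK|aK] := eqVneq (mnm_mod a) a; last first.
  rewrite big1 // => m _; case: eqP => [E|]; last by rewrite mulr0.
  case/eqP: aK; rewrite -E; apply/mnmP => j; by rewrite !mnmE modn_mod.
have : \sum_(t in ffun_on (predC1 (0 : K)))
    g.@[t : {ffun 'I_s -> K}] * (\prod_j t j ^+ (N.-1 * a j)) = 0.
  by rewrite big1 // => t /ffun_onP tT; rewrite g0 ?mul0r // => j; apply: tT.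
under [X in X = _ -> _]eq_bigr do rewrite mevalE mulr_suml.
rewrite exchange_big => sum0; apply: (mulfI (negbT (signr_eq0 K s))).
rewrite mulr0 -[RHS]sum0 mulr_sumr; apply: eq_bigr => m _.
under [in RHS]eq_bigr do rewrite -mulrA.
by rewrite -mulr_sumr sum_torus_monom aK mulrCA.
Qed.

(** Each [tnth v j ^+ N] is 1 modulo the ideal, so exponents may be reduced before substituting, and
    the reduced polynomial is 0. *)
Lemma torus_vanishing_comp_mpoly l (G : set {mpoly K[l]})
    (v : s.-tuple {mpoly K[l]}) (g : {mpoly K[s]}) :
  (forall j, ideal_gen G (tnth v j ^+ N - 1)) ->
  (forall t, torus K s t -> g.@[t] = 0) -> ideal_gen G (g \mPo v).
Proof.
move=> vG /torus_vanishing_mnm_mod /(congr1 (comp_mpoly v)).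
rewrite raddf0 raddf_sum => red0.
rewrite -[_ \mPo _]subr0 -{}red0 comp_mpolyEX -sumrB.
apply: ideal_gen_sum => m _; rewrite /= comp_mpolyZ -scalerBr -mul_mpolyC.
apply: ideal_genMl; rewrite !comp_mpolyX; apply: ideal_genB_prod => j.
rewrite mnmE {1}(divn_eq (m j) N) exprD mulnC exprM -[X in _ - X]mul1r.
apply: ideal_genBM; last by rewrite subrr; apply: ideal_gen0.
by rewrite -(expr1n _ (m j %/ N)%N); apply: ideal_genBX.
Qed.

End TorusVanishing.

(** * Monomial maps given by non-negative integer matrices *)

Section ExponentMap.
Variables (k r : nat) (M : 'M[int]_(k, r)).
Hypothesis M_ge0 : forall j i, 0 <= M j i.

(* These exponents are the entries of M only where M is non-negative. *)
Definition mnm_col (i : 'I_r) : 'X_{1..k} := [multinom absz (M j i) | j < k].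

Definition mnm_image (m : 'X_{1..r}) : 'X_{1..k} := (\sum_i mnm_col i *+ m i)%MM.

Lemma mnm_imageE m j : mnm_image m j = (\sum_i absz (M j i) * m i)%N.
Proof. by rewrite mnm_sumE; apply: eq_bigr => i _; rewrite mulmnE mnmE. Qed.

Lemma prod_mnm_image (A : comNzRingType) (v : 'I_k -> A) (m : 'X_{1..r}) :
  \prod_i (\prod_j v j ^+ absz (M j i)) ^+ m i = \prod_j v j ^+ mnm_image m j.
Proof.
under eq_bigr do rewrite -prodrXl.
rewrite exchange_big; apply: eq_bigr => j _.
by rewrite mnm_imageE expr_sum; apply: eq_bigr => i _; rewrite exprM.
Qed.

Lemma zmonom_col (K : fieldType) (t : 'I_k -> K) i :
  zmonom t (col i M) = \prod_j t j ^+ absz (M j i).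
Proof. by apply: eq_bigr => j _; rewrite mxE -[in LHS](gez0_abs (M_ge0 j i)). Qed.

Lemma beta_degE m : beta_deg M m = \col_j (mnm_image m j)%:Z.
Proof.
apply/colP => j; rewrite summxE mxE mnm_imageE -natz natr_sum.
apply: eq_bigr => i _.
by rewrite mulmxnE mxE -[in LHS](gez0_abs (M_ge0 j i)) natrM mulr_natr natz.
Qed.

(** This lets degrees be handled as exponent vectors of monomials in z. *)
Lemma eq_beta_deg m m' :
  (beta_deg M m = beta_deg M m') <-> (mnm_image m = mnm_image m').
Proof.
rewrite !beta_degE; split => [/colP E|-> //]; apply/mnmP => j.
by have := E j; rewrite !mxE => -[].
Qed.

End ExponentMap.

Lemma prod_exprz (K : fieldType) (I : Type) (l : seq I) (F : I -> K) z :
  (\prod_(i <- l) F i) ^ z = \prod_(i <- l) F i ^ z.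
Proof.
elim: l => [|i l IHl]; first by rewrite !big_nil exp1rz.
by rewrite !big_cons expfzMl IHl.
Qed.

(** * Homogeneous polynomials along an orbit of the kernel *)

Section TorusKernel.
Variables (K : fieldType) (n r d : nat).
Variables (phi : 'M[int]_(r, n)) (beta : 'M[int]_(d, r)).
Hypothesis exact_phi_beta : short_exact phi beta.

(** Exchanging the products turns the left side into the monomial [x] evaluated at
    [torus_map phi g], which is constantly 1. *)
Lemma torus_ker_image g (x : 'cV[int]_n) :
  torus_ker (K := K) phi g -> zmonom g (phi *m x) = 1.
Proof.
move=> [g0 gphi]; transitivity (zmonom (torus_map phi g) x).
  transitivity (\prod_j \prod_i g i ^ (phi i j * x j 0)).
    rewrite exchange_big; apply: eq_bigr => i _ /=; rewrite mxE.
    exact: (big_morph (exprz (g i)) (fun a b => expfzDr a b (g0 i)) (expr0z _)).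
  apply: eq_bigr => j _; rewrite /torus_map /zmonom.
  rewrite prod_exprz; apply: eq_bigr => i _.
  by rewrite mxE exprz_exp.
by rewrite /zmonom big1 // => j _; rewrite gphi exp1rz.
Qed.

(** The difference of the exponents is killed by [beta], so by exactness it is [phi *m x] for some
    [x]. *)
Lemma torus_ker_monom g m m' : torus_ker (K := K) phi g ->
  beta_deg beta m = beta_deg beta m' ->
  \prod_i g i ^+ m i = \prod_i g i ^+ m' i.
Proof.
move=> kg mm'; have [g0 _] := kg.
have /(exact_mid exact_phi_beta)[x xE] : beta *m (\col_i ((m i)%:Z - (m' i)%:Z)) = 0.
  apply/colP => j; rewrite !mxE; have /colP/(_ j) := mm'.
  rewrite !summxE => /eqP; rewrite -subr_eq0 -sumrB => /eqP mm'0.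
  rewrite -[RHS]mm'0; apply: eq_bigr => i _; rewrite !mulmxnE !mxE mulrBr.
  by rewrite -[(m i)%:Z]natz -[(m' i)%:Z]natz !mulr_natr.
have := torus_ker_image x kg; rewrite -{}xE => g1.
transitivity (\prod_i (g i ^ ((\col_i ((m i)%:Z - (m' i)%:Z)) i 0) * g i ^+ m' i)).
  by apply: eq_bigr => i _; rewrite mxE !exprnP -expfzDr ?subrK ?g0.
by rewrite big_split /= [X in X * _]g1 mul1r.
Qed.

Lemma meval_torus_ker g (f : {mpoly K[r]}) :
    torus_ker phi g -> beta_homogeneous beta f ->
  exists c, forall p, f.@[fun i => g i * p i] = c * f.@[p].
Proof.
(* Any monomial of the support gives the same scalar; the default of [head] is reached only when [f]
   is 0. *)
move=> kg [a fa]; exists (\prod_i g i ^+ (head 0%MM (msupp f)) i) => p.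
rewrite !mevalE mulr_sumr big_seq [RHS]big_seq; apply: eq_bigr => m fm.
rewrite mulrCA; congr (_ * _).
under eq_bigr do rewrite exprMn.
rewrite big_split /=; congr (_ * _); apply: torus_ker_monom => //.
rewrite (fa m fm) fa //.
by case: (msupp f) fm => //= m' l _; rewrite inE eqxx.
Qed.

End TorusKernel.

(** * Decomposition into graded components *)

Section Components.
Variables (K : fieldType) (r d : nat) (beta : 'M[int]_(d, r)).
Hypothesis beta_ge0 : forall k i, 0 <= beta k i.

Definition beta_component (a : 'X_{1..d}) (f : {mpoly K[r]}) : {mpoly K[r]} :=
  \sum_(m <- msupp f | mnm_image beta m == a) f@_m *: 'X_[m].

Lemma mcoeff_beta_component a f m :
  (beta_component a f)@_m = if mnm_image beta m == a then f@_m else 0.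
Proof.
rewrite [f in RHS]mpolyE !raddf_sum big_mkcond /=.
case: ifP => ma; last first.
  rewrite big1 // => m' _; case: ifP => // m'a.
  rewrite mcoeffZ mcoeffX; case: eqP => [E|]; last by rewrite mulr0.
  by rewrite -E m'a in ma.
apply: eq_bigr => m' _; case: ifP => // m'a.
rewrite mcoeffZ mcoeffX; case: eqP => [E|]; last by rewrite mulr0.
by rewrite E ma in m'a.
Qed.

Lemma beta_component_homogeneous a f : beta_homogeneous beta (beta_component a f).
Proof.
exists (\col_j (a j)%:Z) => m; rewrite mcoeff_msupp mcoeff_beta_component.
by case: ifP => [/eqP <- _|]; rewrite ?eqxx // beta_degE.
Qed.

(** [undup] lists each degree once, so every coefficient is counted once. *)
Lemma sum_beta_component f :
  f = \sum_(a <- undup [seq mnm_image beta m | m <- msupp f]) beta_component a f.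
Proof.
apply/mpolyP => m; rewrite raddf_sum /=.
under eq_bigr do rewrite mcoeff_beta_component.
have [fm|/memN_msupp_eq0 ->] := boolP (m \in msupp f); last first.
  by rewrite big1 // => a _; case: ifP.
rewrite (bigD1_seq (mnm_image beta m)) ?undup_uniq ?mem_undup ?map_f //=.
by rewrite eqxx big1 ?addr0 // => a; rewrite eq_sym => /negPf ->.
Qed.

(** The exponent of z records the degree of each monomial, while its scalar factor is the value at
    [c]. *)
Lemma mcoeff_comp_graded (c : 'I_r -> K) (v : r.-tuple {mpoly K[d]}) f a :
  (forall i, tnth v i = c i *: 'X_[mnm_col beta i]) ->
  (f \mPo v)@_a = (beta_component a f).@[c].
Proof.
move=> vE; rewrite comp_mpolyE !raddf_sum big_mkcond /=.
rewrite [RHS]big_mkcond /=.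
apply: eq_bigr => m _; rewrite mevalZ mevalX mcoeffZ.
under eq_bigr do rewrite vE exprZn mpolyXn.
rewrite scaler_prod mcoeffZ.
have -> : \prod_i 'X_[mnm_col beta i *+ m i] = 'X_[mnm_image beta m] :> {mpoly K[d]}.
  by rewrite mprodXE.
by rewrite mcoeffX; case: eqP; rewrite ?mulr1 ?mulr0.
Qed.

End Components.

(** * The ideal [J] and its monomial substitutions *)

Section ToricIdeal.
Variables (K : finFieldType) (r s d : nat).
Variables (Q : 'M[int]_(s, r)) (beta : 'M[int]_(d, r)).
Hypothesis Q_ge0 : forall j i, 0 <= Q j i.
Hypothesis beta_ge0 : forall k i, 0 <= beta k i.
Local Notation A := {mpoly K[r + s + d]}.
Local Notation N := (#|K|.-1).

Definition Ytuple : s.-tuple A := [tuple Yvar K r d j | j < s].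

Definition mono_tuple : r.-tuple A :=
  [tuple ymonom K r d (col i Q) * zvmonom K r s (col i beta) | i < r].

Lemma embS_mod_ideal_J f :
  ideal_J K Q beta (embS s d f - (f \mPo mono_tuple)).
Proof.
apply: ideal_gen_comp_mpoly => i; apply: ideal_gen_mem; left.
by exists i; rewrite ?tnth_mktuple.
Qed.

(** Each monomial [m] of [f] becomes a product of a y-monomial and a z-monomial; the z-part is the
    same for all [m] and factors out. *)
Lemma comp_mono_tuple f a :
  (forall m, m \in msupp f -> mnm_image beta m = a) ->
  f \mPo mono_tuple = (\prod_k Zvar K r s k ^+ a k) *
    ((\sum_(m <- msupp f) f@_m *: 'X_[mnm_image Q m]) \mPo Ytuple).
Proof.
move=> fa; rewrite comp_mpolyE raddf_sum mulr_sumr big_seq [RHS]big_seq.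
apply: eq_bigr => m fm; rewrite /= comp_mpolyZ -scalerAr; congr (_ *: _).
rewrite comp_mpolyX -(fa m fm).
under eq_bigr do rewrite tnth_mktuple exprMn.
rewrite big_split mulrC /ymonom /zvmonom /=; congr (_ * _).
  under eq_bigr do under eq_bigr do rewrite mxE.
  by rewrite prod_mnm_image; apply: eq_bigr => j _; rewrite tnth_mktuple.
under eq_bigr do under eq_bigr do rewrite mxE.
exact: prod_mnm_image.
Qed.

Lemma meval_sum_mnm_image (f : {mpoly K[r]}) (t : 'I_s -> K) :
  (\sum_(m <- msupp f) f@_m *: 'X_[mnm_image Q m]).@[t] =
  f.@[fun i => zmonom t (col i Q)].
Proof.
rewrite [RHS]mevalE raddf_sum; apply: eq_bigr => m _ /=.
rewrite mevalZ mevalX -prod_mnm_image.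
by congr (_ * _); apply: eq_bigr => i _; rewrite zmonom_col.
Qed.

Lemma vanishing_homogeneous_ideal_J f :
  beta_homogeneous beta f ->
  (forall t, torus K s t -> f.@[fun i => zmonom t (col i Q)] = 0) ->
  ideal_J K Q beta (embS s d f).
Proof.
move=> [alpha falpha] f0; rewrite -[embS s d f](subrK (f \mPo mono_tuple)).
apply: ideal_genD; first exact: embS_mod_ideal_J.
(* The common degree is read off the first monomial of the support, as a natural exponent vector. *)
rewrite (@comp_mono_tuple f (mnm_image beta (head 0%MM (msupp f)))) => [|m fm].
  apply: ideal_genMl; apply: torus_vanishing_comp_mpoly => [j|t tT].
    by apply: ideal_gen_mem; right; exists j; rewrite ?tnth_mktuple.
  by rewrite meval_sum_mnm_image f0.
apply/(eq_beta_deg beta_ge0); rewrite !falpha //.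
by case: (msupp f) fm => //= m' l _; rewrite inE eqxx.
Qed.

(** The outer [split] separates z from the rest, the inner one x from y. The z-variables survive to
    keep track of the grading. *)
Definition torus_eval (t : 'I_s -> K) : (r + s + d).-tuple {mpoly K[d]} :=
  [tuple match fintype.split i with
         | inl u => match fintype.split u with
                    | inl i => zmonom t (col i Q) *: 'X_[mnm_col beta i]
                    | inr j => (t j)%:MP
                    end
         | inr k => 'X_k
         end | i < r + s + d].

Lemma torus_eval_Xvar t i :
  Xvar K s d i \mPo torus_eval t = zmonom t (col i Q) *: 'X_[mnm_col beta i].
Proof.
by rewrite comp_mpolyXU -tnth_nth tnth_mktuple (unsplitK (inl _)) (unsplitK (inl _)).
Qed.

Lemma torus_eval_Yvar t j : Yvar K r d j \mPo torus_eval t = (t j)%:MP.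
Proof.
by rewrite comp_mpolyXU -tnth_nth tnth_mktuple (unsplitK (inl _)) (unsplitK (inr _)).
Qed.

Lemma torus_eval_Zvar t k : Zvar K r s k \mPo torus_eval t = 'X_k.
Proof. by rewrite comp_mpolyXU -tnth_nth tnth_mktuple (unsplitK (inr _)). Qed.

Lemma torus_eval_ideal_J t f :
  torus K s t -> ideal_J K Q beta f -> f \mPo torus_eval t = 0.
Proof.
move=> tT; apply: (ideal_gen_kernel (h := comp_mpoly (torus_eval t))).
move=> _ [[i _ <-]|[j _ <-]] /=.
  rewrite rmorphB rmorphM !rmorph_prod /= torus_eval_Xvar.
  under eq_bigr do rewrite rmorphXn /= torus_eval_Yvar mxE -rmorphXn.
  under [X in _ * X]eq_bigr do rewrite rmorphXn /= torus_eval_Zvar mxE.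
  rewrite -rmorph_prod /= mul_mpolyC zmonom_col // mpolyXE_id.
  apply/eqP; rewrite subr_eq0; apply/eqP; congr (_ *: _).
  by apply: eq_bigr => k _; rewrite mnmE.
rewrite rmorphB rmorphXn rmorph1 /= torus_eval_Yvar -rmorphXn /=.
by rewrite expf_pred_card ?subrr // tT.
Qed.

Lemma ideal_J_component_vanishing f t a :
  torus K s t -> ideal_J K Q beta (embS s d f) ->
  (beta_component beta a f).@[fun i => zmonom t (col i Q)] = 0.
Proof.
move=> tT /(torus_eval_ideal_J tT) f0; rewrite -[RHS](mcoeff0 _ a) -{}f0.
pose v : r.-tuple {mpoly K[d]} :=
  [tuple zmonom t (col i Q) *: 'X_[mnm_col beta i] | i < r].
rewrite -(mcoeff_comp_graded (v := v)) => [|i]; last by rewrite tnth_mktuple.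
congr (_@_a); rewrite /embS [in RHS](comp_mpolyE f) [LHS]comp_mpolyE raddf_sum.
apply: eq_bigr => m _ /=.
rewrite comp_mpolyZ rmorph_prod; congr (_ *: _); apply: eq_bigr => i _ /=.
by rewrite rmorphXn !tnth_mktuple /= torus_eval_Xvar.
Qed.

End ToricIdeal.

Theorem theorem2p6 (R : realType) (K : finFieldType) (n r d s : nat)
  (Sigma : set (set 'rV[R]_n))
  (phi : 'M[int]_(r, n)) (beta : 'M[int]_(d, r)) (Q : 'M[int]_(s, r))
  (fan_Sigma : is_fan Sigma)
  (complete_Sigma : complete_fan Sigma)
  (simplicial_Sigma : simplicial_fan Sigma)
  (phi_rays : ray_generators Sigma phi)
  (phi_beta_exact : short_exact phi beta)
  (beta_ge0 : forall k i, 0 <= beta k i)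
  (Q_ge0 : forall j i, 0 <= Q j i) :
  vanishing_ideal beta (toric_set K phi Q) =
  embS s d @^-1` ideal_J K Q beta.
Proof.
apply/seteqP; split=> f /=.
  move=> [cs [csV ->]]; rewrite /embS raddf_sum.
  apply: ideal_gen_sum => c /csV[c_hom c0]; rewrite /= rmorphM.
  apply: ideal_genMl; apply: vanishing_homogeneous_ideal_J => // t tT.
  apply: (c0 (toric_point phi (fun i => zmonom t (col i Q)))); first by exists t.
  (* The neutral element of the kernel puts the representative in its own orbit. *)
  exists (fun=> 1); last by apply/funext => i; rewrite mul1r.
  split=> [i|]; first exact: oner_neq0.
  apply/funext => j; rewrite /torus_map /zmonom big1 // => i _.
  by rewrite exp1rz.
(* It suffices that each graded component vanishes on the toric set. *)
move=> fJ; rewrite (sum_beta_component beta f); apply: ideal_gen_sum => a _.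
apply: ideal_gen_mem; split; first exact: beta_component_homogeneous.
move=> _ [t tT <-] _ [g gG <-].
(* Passing to another representative of the orbit only multiplies the value by a scalar. *)
have fa_hom := beta_component_homogeneous beta_ge0 a f.
have [c ->] := meval_torus_ker phi_beta_exact gG fa_hom.
by rewrite ideal_J_component_vanishing ?mulr0.
Qed.
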